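(* Let $X_1,\dots,X_n$ be independent nonnegative lifetimes with common absolutely continuous distribution function $F(\cdot,\theta)$ depending on parameter(s) $\theta$. Let $l,r\in\{1,\dots,n\}$ with $l<r$, and let $0<T_1<T_2<\infty$. Let $D$ be the number of failures observed under the Type-II unified hybrid censoring scheme with design parameters $(n,r,l,T_1,T_2)$. Then $$E[D]=l+nF(T_1,\theta)+N_{X_{r:n}\wedge T_2}-N_{X_{l:n}\wedge T_2}-N_{X_{r:n}\wedge T_1},$$ where $N_{X_{r:n}\wedge T_2}$, $N_{X_{l:n}\wedge T_2}$ and $N_{X_{r:n}\wedge T_1}$ denote the expected numbers of failures under the Type-I hybrid censoring schemes $(r,T_2)$, $(l,T_2)$ and $(r,T_1)$, respectively.
   Context: Notation: $X_{1:n}<X_{2:n}<\cdots<X_{n:n}$ are the (almost surely distinct) order statistics of $X_1,\dots,X_n$, i.e. the ordered failure times of the $n$ units placed on test; $x\wedge y=\min(x,y)$ and $x\vee y=\max(x,y)$. Type-II unified hybrid censoring scheme (Type-II UHCS) with parameters $(n,r,l,T_1,T_2)$: the test is terminated at the random time $\xi$ given (outside a null event) by - $\xi=T_1$ if $X_{l:n}<X_{r:n}<T_1<T_2$; - $\xi=X_{r:n}$ if $X_{l:n}<T_1<X_{r:n}<T_2$; - $\xi=T_2$ if $X_{l:n}<T_1<T_2<X_{r:n}$; - $\xi=X_{r:n}$ if $T_1<X_{l:n}<X_{r:n}<T_2$; - $\xi=T_2$ if $T_1<X_{l:n}<T_2<X_{r:n}$; - $\xi=X_{l:n}$ if $T_1<T_2<X_{l:n}<X_{r:n}$.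 Equivalently $\xi=(X_{l:n}\vee T_2)\wedge(X_{r:n}\vee T_1)$. The number of failures is $D=\#\{i: X_{i:n}\le \xi\}$. Type-I hybrid censoring scheme $(k,T)$, with $k\in\{1,\dots,n\}$ and $T>0$: the test on the same $n$ units is terminated at time $X_{k:n}\wedge T$. Its expected number of failures is $N_{X_{k:n}\wedge T}=E\big[\#\{i: X_{i:n}\le X_{k:n}\wedge T\}\big]$. *)

(* Defs.v *)
From HB Require Import structures.
From mathcomp Require Import all_boot all_order all_algebra.
From mathcomp Require Import all_classical all_reals all_analysis.

Set Implicit Arguments.
Unset Strict Implicit.
Unset Printing Implicit Defensive.

Import Order.TTheory GRing.Theory Num.Theory.
Import numFieldNormedType.Exports.

Local Open Scope classical_set_scope.
Local Open Scope ring_scope.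

Definition mutually_independent (d : measure_display) (T : measurableType d)
    (R : realType) (P : probability T R) (I : finType) (X : I -> {RV P >-> R}) :
    Prop :=
  forall (J : {set I}) (A : I -> set R),
    (forall i, i \in J -> measurable (A i)) ->
    P (\bigcap_(i in [set` J]) (X i @^-1` A i)) =
    (\prod_(i in J) P (X i @^-1` A i))%E.

(* The epsilon-delta notion, uniform over all of R. For a distribution function
   this is the same as absolute continuity on every compact interval. *)
Definition absolutely_continuous (R : realType) (f : R -> R) : Prop :=
  forall e : R, 0 < e -> exists2 delta : R, 0 < delta &
    forall (m : nat) (a b : 'I_m -> R),
      (forall i, a i < b i) ->
      trivIset [set: 'I_m] (fun i => `]a i, b i[%classic) ->
      \sum_(i < m) (b i - a i) < delta ->
      \sum_(i < m) `|f (b i) - f (a i)| < e.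

(* The sample is a point x of R^n. The index k runs from 1 to n, as in X_{k:n};
   the value at any other k carries no meaning. *)
Definition order_stat (R : realType) (n : nat) (x : 'I_n -> R) (k : nat) : R :=
  nth 0 (sort <=%R (codom x)) k.-1.

Definition num_failures (R : realType) (n : nat) (x : 'I_n -> R) (t : R) : nat :=
  #|[pred i : 'I_n | order_stat x i.+1 <= t]|.

Definition typeI_hybrid_time (R : realType) (n : nat) (k : nat) (T : R)
    (x : 'I_n -> R) : R :=
  Num.min (order_stat x k) T.

Definition typeI_hybrid_failures (d : measure_display) (Omega : measurableType d)
    (R : realType) (P : probability Omega R) (n : nat)
    (X : 'I_n -> {RV P >-> R}) (k : nat) (T : R) : \bar R :=
  ('E_P[fun w => (num_failures (X ^~ w) (typeI_hybrid_time k T (X ^~ w)))%:R])%E.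

(* t is left unconstrained when there is a tie among X_{l:n}, X_{r:n}, T1, T2;
   for lifetimes with a continuous distribution ties form a null event. *)
Definition typeII_UHCS_stops_at (R : realType) (n r l : nat) (T1 T2 : R)
    (x : 'I_n -> R) (t : R) : Prop :=
  let xl := order_stat x l in
  let xr := order_stat x r in
  ([&& xl < xr, xr < T1 & T1 < T2] -> t = T1) /\
  ([&& xl < T1, T1 < xr & xr < T2] -> t = xr) /\
  ([&& xl < T1, T1 < T2 & T2 < xr] -> t = T2) /\
  ([&& T1 < xl, xl < xr & xr < T2] -> t = xr) /\
  ([&& T1 < xl, xl < T2 & T2 < xr] -> t = T2) /\
  ([&& T1 < T2, T2 < xl & xl < xr] -> t = xl).

(* Main.v *)
Require Import Defs.
From HB Require Import structures.
From mathcomp Require Import all_boot all_order all_algebra.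
From mathcomp Require Import all_classical all_reals all_analysis.
From mathcomp Require Import ring lra measurable_realfun.

(* Let N(t) be the number of i with X_i <= t. Off the null event where two
   lifetimes coincide or a lifetime equals T1 or T2, N(X_{l:n}) = l, and the six
   stopping cases each give
     N(xi) + N(X_{l:n} /\ T2) + N(X_{r:n} /\ T1)
       = l + N(T1) + N(X_{r:n} /\ T2);
   taking expectations yields the formula, since E[N(T1)] = n F(T1). *)

Set Implicit Arguments.
Unset Strict Implicit.
Unset Printing Implicit Defensive.

Import Order.TTheory GRing.Theory Num.Theory.
Import numFieldNormedType.Exports.

Local Open Scope classical_set_scope.
Local Open Scope ring_scope.

(** * Pointwise counting of failures and order statistics *)

Lemma num_failures_count (R : realType) (n : nat) (x : 'I_n -> R) (t : R) :
  num_failures x t = count (<= t) (sort <=%R (codom x)).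
Proof.
rewrite /num_failures -sum1_card.
rewrite -sum1_count [RHS](big_nth 0) size_sort size_codom card_ord.
by rewrite big_mkord.
Qed.

(** Counting is invariant under sorting, so the lifetimes themselves can replace their order
    statistics. This form leads to indicators, hence to measurability and expectations. *)
Lemma num_failuresE (R : realType) (n : nat) (x : 'I_n -> R) (t : R) :
  num_failures x t = (\sum_(i < n) (x i <= t)%R)%N.
Proof.
rewrite num_failures_count count_sort codomE count_map -size_filter -sum1_size.
rewrite big_filter big_mkcond/= big_enum /=.
by apply: eq_bigr => i _; case: ifP.
Qed.

(** The k-th smallest value sits at index [k.-1] of the sorted list, whose entries [<= t] form an
    initial segment of length [num_failures x t]. Ties do no harm here. *)
Lemma order_stat_le (R : realType) (n : nat) (x : 'I_n -> R) (k : nat) (t : R) :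
  (1 <= k <= n)%N -> (order_stat x k <= t) = (k <= num_failures x t)%N.
Proof.
case: k => // k /= kn; rewrite num_failures_count /order_stat /=.
have ss : sorted <=%R (sort <=%R (codom x)) by apply: sort_sorted; exact: le_total.
case: ltnP => h; first exact: nth_count_le.
apply/negbTE; rewrite -ltNge; apply: nth_count_gt => //.
by rewrite h size_sort size_codom card_ord.
Qed.

(** Injectivity makes the sorted list strictly increasing; a tie at the k-th value could push the
    count above k. *)
Lemma num_failures_order_stat (R : realType) (n : nat) (x : 'I_n -> R) (k : nat) :
  injective x -> (1 <= k <= n)%N -> num_failures x (order_stat x k) = k.
Proof.
case: k => // k xI /= kn; rewrite num_failures_count /order_stat /=.
apply: count_le_nth; last by rewrite size_sort size_codom card_ord.
by rewrite sort_lt_sorted; apply/injectiveP.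
Qed.

(** Serves to carry [x i != T1] and [x i != T2] over to order statistics. *)
Lemma order_stat_codom (R : realType) (n : nat) (x : 'I_n -> R) (k : nat) :
  (1 <= k <= n)%N -> exists i, order_stat x k = x i.
Proof.
case: k => // k /= kn.
have : order_stat x k.+1 \in codom x.
  by rewrite -(mem_sort <=%R) mem_nth// size_sort size_codom card_ord.
by move=> /codomP.
Qed.

(** By [order_stat_le], the reverse inequality would say that k is at most the count at the j-th
    order statistic, which is j. *)
Lemma order_stat_lt (R : realType) (n : nat) (x : 'I_n -> R) (j k : nat) :
  injective x -> (1 <= j)%N -> (j < k)%N -> (k <= n)%N ->
  order_stat x j < order_stat x k.
Proof.
move=> xI j1 jk kn.
have kn' : (1 <= k <= n)%N by rewrite kn andbT (leq_trans j1)// ltnW.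
have jn' : (1 <= j <= n)%N by rewrite j1 (leq_trans _ kn)// ltnW.
by rewrite ltNge order_stat_le// num_failures_order_stat// -ltnNge.
Qed.

(** Every term stands on the side where its sign is positive, which keeps the identity in [nat]
    clear of truncated subtraction. *)
Lemma num_failures_UHCS (R : realType) (n r l : nat) (T1 T2 : R)
    (x : 'I_n -> R) (t : R) :
    injective x -> (forall i, x i != T1) -> (forall i, x i != T2) ->
    (1 <= l)%N -> (l < r)%N -> (r <= n)%N -> T1 < T2 ->
    typeII_UHCS_stops_at r l T1 T2 x t ->
  (num_failures x t + num_failures x (typeI_hybrid_time l T2 x) +
     num_failures x (typeI_hybrid_time r T1 x) =
   l + num_failures x T1 + num_failures x (typeI_hybrid_time r T2 x))%N.
Proof.
move=> xI xT1 xT2 l1 lr rn T12.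
have ln : (1 <= l <= n)%N by rewrite l1 (leq_trans _ rn)// ltnW.
have rn' : (1 <= r <= n)%N by rewrite rn andbT (leq_trans l1)// ltnW.
have xlr := order_stat_lt xI l1 lr rn.
have [[i xli] [j xrj]] := (order_stat_codom x ln, order_stat_codom x rn').
have lT1 : order_stat x l != T1 by rewrite xli.
have lT2 : order_stat x l != T2 by rewrite xli.
have rT1 : order_stat x r != T1 by rewrite xrj.
have rT2 : order_stat x r != T2 by rewrite xrj.
have Nl := num_failures_order_stat xI ln.
(* Once l is written as the count at [order_stat x l], both sides are sums of counts; in each
   stopping case they agree up to the order of the terms. *)
rewrite /typeII_UHCS_stops_at /typeI_hybrid_time -[X in _ = (X + _ + _)%N]Nl.
move: (order_stat x l) (order_stat x r) xlr lT1 lT2 rT1 rT2 => a b ab aT1 aT2 bT1 bT2.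
rewrite /= ab T12 !andbT /= => -[H1 [H2 [H3 [H4 [H5 H6]]]]].
have [aT|Ta|e] := ltgtP a T1; last by rewrite e eqxx in aT1.
- have aU := lt_trans aT T12; rewrite (min_idPl (ltW aU)).
  have [bT|Tb|e] := ltgtP b T1; last by rewrite e eqxx in bT1.
  + by rewrite (H1 bT) (min_idPl (ltW (lt_trans bT T12))); ring.
  + have [bU|Ub|e] := ltgtP b T2; last by rewrite e eqxx in bT2.
    * by rewrite H2 ?aT ?Tb//; ring.
    * by rewrite H3 ?aT ?Ub//; ring.
- have Tb := lt_trans Ta ab; rewrite (min_idPr (ltW Tb)).
  have [aU|Ua|e] := ltgtP a T2; last by rewrite e eqxx in aT2.
  + have [bU|Ub|e] := ltgtP b T2; last by rewrite e eqxx in bT2.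
    * by rewrite H4 ?Ta ?bU//; ring.
    * by rewrite H5 ?Ta ?aU ?Ub//; ring.
  + by rewrite (H6 Ua) (min_idPr (ltW (lt_trans Ua ab))); ring.
Qed.

(** * Measurability, integrability and expectation of failure counts *)

Lemma num_failures_indic (R : realType) (T : Type) (n : nat) (X : 'I_n -> T -> R)
    (t : T -> R) (w : T) :
  (num_failures (X ^~ w) (t w))%:R =
  \sum_(i < n) \1_[set v | X i v <= t v] w :> R.
Proof.
rewrite num_failuresE natr_sum; apply: eq_bigr => i _.
by rewrite indicE mem_setE.
Qed.

Lemma measurable_le_set d (T : measurableType d) (R : realType) (f g : T -> R) :
  measurable_fun setT f -> measurable_fun setT g ->
  measurable [set w | f w <= g w].
Proof.
by move=> mf mg; rewrite -[X in measurable X]setTI; exact: measurable_fun_le.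
Qed.

Lemma measurable_num_failures d (T : measurableType d) (R : realType) (n : nat)
    (X : 'I_n -> T -> R) (t : T -> R) :
    (forall i, measurable_fun setT (X i)) -> measurable_fun setT t ->
  measurable_fun setT (fun w => (num_failures (X ^~ w) (t w))%:R : R).
Proof.
move=> mX mt; under eq_fun do rewrite num_failures_indic.
apply: measurable_sum => i; apply: measurable_indic.
exact: measurable_le_set.
Qed.

Lemma measurable_order_stat d (T : measurableType d) (R : realType) (n : nat)
    (X : 'I_n -> T -> R) (k : nat) :
    (forall i, measurable_fun setT (X i)) -> (1 <= k <= n)%N ->
  measurable_fun setT (fun w => order_stat (X ^~ w) k).
Proof.
move=> mX kn mD; apply: (measurability _ (RGenOInfty.measurableE R)) => //.
move=> /= _ [_ [x ->] <-]; apply: measurableI => //.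
(* By [order_stat_le], the order statistic exceeds x exactly when fewer than k lifetimes are [<= x],
   and that count is already measurable. *)
have -> : (fun w => order_stat (X ^~ w) k) @^-1` `]x, +oo[ =
    ~` [set w | k%:R <= (num_failures (X ^~ w) x)%:R :> R].
  apply/seteqP; split=> w /=; rewrite in_itv /= andbT ler_nat ltNge order_stat_le//.
    by move/negP.
  by move/negP.
apply: measurableC; apply: measurable_le_set => //.
exact: (@measurable_num_failures _ _ _ _ _ (cst x)).
Qed.

Lemma measurable_typeI_hybrid_time d (T : measurableType d) (R : realType)
    (n : nat) (X : 'I_n -> T -> R) (k : nat) (c : R) :
    (forall i, measurable_fun setT (X i)) -> (1 <= k <= n)%N ->
  measurable_fun setT (fun w => typeI_hybrid_time k c (X ^~ w)).
Proof.
move=> mX kn; apply: measurable_minr => //; exact: measurable_order_stat.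
Qed.

Lemma Lfun1_num_failures d (T : measurableType d) (R : realType)
    (P : probability T R) (n : nat) (X : 'I_n -> T -> R) (t : T -> R) :
    (forall i, measurable_fun setT (X i)) -> measurable_fun setT t ->
  (fun w => (num_failures (X ^~ w) (t w))%:R : R) \in Lfun P 1.
Proof.
move=> mX mt; apply/Lfun1_integrable.
(* The count is dominated by the constant n. *)
have := finite_measure_integrable_cst P (n%:R : R) measurableT.
apply: le_integrable => //.
  by apply/measurable_EFinP; exact: measurable_num_failures.
move=> w _; rewrite /= lee_fin !normr_nat ler_nat.
by rewrite (leq_trans (max_card _))// card_ord.
Qed.

Lemma expectation_num_failures_cst d (T : measurableType d) (R : realType)
    (P : probability T R) (n : nat) (X : 'I_n -> {RV P >-> R}) (c : R) :
  ('E_P[fun w => (num_failures (X ^~ w) c)%:R] = \sum_(i < n) cdf (X i) c)%E.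
Proof.
have mX i : measurable [set w | X i w <= c] by exact: measurable_le_set.
rewrite unlock.
under eq_integral => w _ do
  rewrite (num_failures_indic (fun i => X i) (cst c)) -sumEFin.
rewrite ge0_integral_sum//=.
- apply: eq_bigr => i _; rewrite integral_indic// setIT /cdf /distribution /=.
  by congr (P _); apply/seteqP; split => w /=; rewrite in_itv.
- by move=> i; apply/measurable_EFinP; exact: measurable_indic.
Qed.

Lemma expectation_ae_eq d (T : measurableType d) (R : realType)
    (P : probability T R) (f g : T -> R) :
    measurable_fun setT f -> measurable_fun setT g ->
    {ae P, forall w, f w = g w} ->
  ('E_P[f] = 'E_P[g])%E.
Proof.
move=> mf mg fg; rewrite unlock; apply: ae_eq_integral => //.
- exact/measurable_EFinP.
- exact/measurable_EFinP.
- by apply: filterS fg => w /= ->.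
Qed.

(** * Null events: lifetimes hitting a constant, and ties *)

(** Uniform continuity, obtained from a family of one interval ([m = 1]), for which disjointness is
    trivial. *)
Lemma absolutely_continuous_unif (R : realType) (f : R -> R) (e : R) :
  absolutely_continuous f -> 0 < e ->
  exists2 delta : R, 0 < delta &
    forall a b, a < b -> b - a < delta -> `|f b - f a| < e.
Proof.
move=> fac /fac[delta d0 H]; exists delta => // a b ab bad.
have := H 1%N (fun=> a) (fun=> b) (fun=> ab) _.
by rewrite !big_ord1; apply => // i j _ _ _; rewrite !ord1.
Qed.

Lemma cdf_itv d (T : measurableType d) (R : realType) (P : probability T R)
    (X : {RV P >-> R}) (a b : R) : a <= b ->
  P (X @^-1` `]a, b]) = (cdf X b - cdf X a)%E.
Proof.
move=> ab.
have mX (i : interval R) : measurable (X @^-1` [set` i]).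
  by apply: measurable_funPTI; exact: measurable_itv.
rewrite -[cdf X b]/(P (X @^-1` _)) -[cdf X a]/(P (X @^-1` _)).
have -> : X @^-1` `]-oo, b] = X @^-1` `]-oo, a] `|` X @^-1` `]a, b].
  rewrite -preimage_setU; congr (_ @^-1` _); apply/seteqP; split => x /=.
    by rewrite !in_itv/= => xb; case: (leP x a) => xa; [left|right; rewrite xb].
  by rewrite !in_itv/= => -[xa|/andP[]//]; exact: le_trans ab.
rewrite measureU//; last first.
  by apply/seteqP; split => x //=; rewrite !in_itv /= => -[xa /andP[]]; rewrite ltNge xa.
by rewrite addeAC subee ?add0e// fin_num_measure.
Qed.

(** One delta serves every location on the line, so a single mesh size will bound the mass of all
    cells at once. *)
Lemma cdf_small_mass d (T : measurableType d) (R : realType)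
    (P : probability T R) (X : {RV P >-> R}) (f : R -> R) (e : R) :
    (forall t, cdf X t = (f t)%:E) -> absolutely_continuous f -> 0 < e ->
  exists2 delta : R, 0 < delta &
    forall a b, a < b -> b - a < delta -> (P (X @^-1` `]a, b]) <= e%:E)%E.
Proof.
move=> Xf /absolutely_continuous_unif/[apply] -[delta d0 H].
exists delta => // a b ab bad; rewrite (cdf_itv _ (ltW ab)) !Xf -EFinB lee_fin ltW//.
by rewrite (le_lt_trans (ler_norm _))// H.
Qed.

Lemma ae_neq_cst d (T : measurableType d) (R : realType)
    (P : probability T R) (X : {RV P >-> R}) (f : R -> R) (c : R) :
    (forall t, cdf X t = (f t)%:E) -> absolutely_continuous f ->
  {ae P, forall w, X w != c}.
Proof.
move=> Xf fac.
have mE : measurable (X @^-1` [set c]) by exact: measurable_funPTI.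
exists (X @^-1` [set c]); split => //; last first.
  by move=> w /= /negP; rewrite negbK => /eqP.
apply/eqP; rewrite eq_le measure_ge0 andbT; apply/lee_addgt0Pr => e e0.
rewrite add0e; have [delta d0 H] := cdf_small_mass Xf fac e0.
(* The point c is enclosed in the left-open interval from [c - delta / 2] to c, short enough to have
   mass at most e. *)
apply: le_trans (H (c - delta / 2) c _ _); [|lra|lra].
apply: le_measure; rewrite ?inE//; first exact: measurable_funPTI.
by move=> w /= ->; rewrite in_itv/= lexx andbT; lra.
Qed.

Lemma mutually_independent_pair d (T : measurableType d) (R : realType)
    (P : probability T R) (I : finType) (X : I -> {RV P >-> R}) (i j : I)
    (A B : set R) :
    mutually_independent X -> i != j -> measurable A -> measurable B ->
  (P (X i @^-1` A `&` X j @^-1` B) = P (X i @^-1` A) * P (X j @^-1` B))%E.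
Proof.
move=> Xind ij mA mB.
(* The family equals A at i and B elsewhere; since i and j differ, its value at j is B. *)
have := Xind [set i; j]%SET (fun k => if k == i then A else B).
rewrite big_setU1 ?inE//= big_set1 eqxx eq_sym (negbTE ij) => <-; last first.
  by move=> k _; case: ifP.
congr (P _); apply/seteqP; split => w /=.
  by move=> [wA wB] k /=; rewrite !inE; case: ifP => [/eqP->|_ /= /eqP->].
move=> H; split; first by have := H i; rewrite /= !inE eqxx; apply.
by have := H j; rewrite /= !inE eqxx orbT eq_sym (negbTE ij); apply.
Qed.

(* Cut [0, +oo[ into cells of length h: two equal lifetimes lie in a common
   cell, which by independence has probability at most e * P (X i in cell). *)
Lemma ae_neq_indep d (T : measurableType d) (R : realType)
    (P : probability T R) (I : finType) (X : I -> {RV P >-> R}) (f : R -> R)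
    (i j : I) :
    mutually_independent X -> i != j -> {ae P, forall w, 0 <= X i w} ->
    (forall t, cdf (X j) t = (f t)%:E) -> absolutely_continuous f ->
  {ae P, forall w, X i w != X j w}.
Proof.
move=> Xind ij Xi0 Xf fac.
(* Nonnegativity is built into the event because the cells cover only the half-line from 0. *)
pose E := [set w | X i w = X j w] `&` [set w | 0 <= X i w].
have mE : measurable E.
  apply: measurableI; last exact: measurable_le_set.
  have -> : [set w | X i w = X j w] =
      [set w | X i w <= X j w] `&` [set w | X j w <= X i w].
    apply/seteqP; split => w /=; first by move=> ->.
    by move=> [ij1 ij2]; apply/eqP; rewrite eq_le ij1.
  by apply: measurableI; exact: measurable_le_set.
suff E0 : {ae P, forall w, ~ E w}.
  apply: filterS2 Xi0 E0 => w Xiw Ew; apply/eqP => Xij.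
  by apply: Ew; split.
exists E; split => //; last by move=> w /= /contrapT.
apply/eqP; rewrite eq_le measure_ge0 andbT; apply/lee_addgt0Pr => e e0.
rewrite add0e; have [delta d0 H] := cdf_small_mass Xf fac e0.
(* A cell is closed on the left, while mass bounds are for left-open intervals. Extending it by h to
   the left gives length [2 * h], still below delta. *)
pose h := delta / 3; have h0 : 0 < h by rewrite /h; lra.
pose C (k : nat) : set R := `[k%:R * h, k.+1%:R * h[%classic.
(* A point determines the index of its cell; this later gives disjointness of the cells. *)
have CE k x : C k x -> k = Num.truncn (x / h).
  rewrite /C /= in_itv /= => /andP[kx xk]; apply/esym/truncn_def.
  by rewrite ler_pdivlMr// kx ltr_pdivrMr.
have mC k : measurable (C k) by exact: measurable_itv.
have mX k l : measurable (X k @^-1` C l) by exact: measurable_funPTI.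
have EC : E `<=` \bigcup_k (X i @^-1` C k `&` X j @^-1` C k).
  move=> w [/= Xij Xiw]; exists (Num.truncn (X i w / h)) => //=.
  rewrite -Xij; suff Cw : C (Num.truncn (X i w / h)) (X i w) by split.
  rewrite /C /= in_itv /= -ler_pdivlMr// -ltr_pdivrMr//.
  by apply: truncn_itv; rewrite divr_ge0// ltW.
have Ce k : (P (X j @^-1` C k) <= e%:E)%E.
  apply: le_trans (H (k%:R * h - h) (k.+1%:R * h) _ _); last 2 first.
  - by rewrite -natr1 mulrDl mul1r; lra.
  - by rewrite -natr1 mulrDl mul1r /h; lra.
  apply: le_measure; rewrite ?inE//.
    by apply: measurable_funPTI; exact: measurable_itv.
  move=> w; rewrite /C /= !in_itv /= => /andP[kx xk].
  by rewrite ltW// andbT (lt_le_trans _ kx)// ltrBlDr ltrDl.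
have PC k : (P (X i @^-1` C k `&` X j @^-1` C k) <= e%:E * P (X i @^-1` C k))%E.
  rewrite (mutually_independent_pair Xind ij (mC k) (mC k)) muleC.
  by apply: lee_wpmul2r; [exact: measure_ge0|exact: Ce].
have mCC k : measurable (X i @^-1` C k `&` X j @^-1` C k) by exact: measurableI.
apply: (le_trans (measure_sigma_subadditive _ mCC mE EC)).
apply: (@le_trans _ _ (\sum_(0 <= k <oo) (e%:E * P (X i @^-1` C k)))%E).
  by apply: lee_nneseries => k _; [move=> _; exact: measure_ge0|exact: PC].
rewrite nneseriesZl; last by move=> k _; exact: measure_ge0.
(* Disjointness turns the sum of the cell probabilities of [X i] into the probability of a union, at
   most 1, so the total bound is e. *)
have CT : trivIset setT (fun k => X i @^-1` C k).
  by move=> k l _ _ [w [/= /CE -> /CE ->]].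
have := measure_bigcup P setT (fun k => X i @^-1` C k) (fun k _ => mX i k) CT.
rewrite (@eq_eseriesl _ _ predT) => [<-|k]; last by rewrite in_setT.
rewrite -[leRHS]mule1; apply: lee_wpmul2l; first by rewrite lee_fin ltW.
by apply: probability_le1; exact: bigcupT_measurable.
Qed.

(** There are finitely many pairs of indices, so the almost sure events of [ae_neq_indep] can be
    intersected. *)
Lemma ae_injective d (T : measurableType d) (R : realType)
    (P : probability T R) (I : finType) (X : I -> {RV P >-> R}) (f : R -> R) :
    mutually_independent X -> (forall i, {ae P, forall w, 0 <= X i w}) ->
    (forall i t, cdf (X i) t = (f t)%:E) -> absolutely_continuous f ->
  {ae P, forall w, injective (X ^~ w)}.
Proof.
move=> Xind X0 Xf fac.
have H (p : I * I) : {ae P, forall w, p.1 != p.2 -> X p.1 w != X p.2 w}.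
  have [p12|p12] := boolP (p.1 == p.2); first exact: aeW.
  by apply: filterS (ae_neq_indep Xind p12 (X0 _) (Xf _) fac) => w ? _.
have Hall : {ae P, forall w, forall p : I * I, p.1 != p.2 -> X p.1 w != X p.2 w}.
  exact: filter_forall.
apply: filterS Hall => w Hw i j /= Xij.
by apply/eqP; apply: contraT => /(Hw (i, j)); rewrite /= Xij eqxx.
Qed.

(** * Passage from the pointwise identity to expectations *)

Theorem theorem1 (R : realType) (d : measure_display) (Omega : measurableType d)
    (P : probability Omega R) (Theta : Type) (F : R -> Theta -> R)
    (theta : Theta) (n : nat) (X : 'I_n -> {RV P >-> R})
    (X_indep : mutually_independent X)
    (X_ge0 : forall i, {ae P, forall w, 0 <= X i w})
    (X_cdf : forall i t, cdf (X i) t = (F t theta)%:E)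
    (F_ac : absolutely_continuous (F ^~ theta))
    (l r : nat) (l_ge1 : (1 <= l)%N) (l_lt_r : (l < r)%N) (r_le_n : (r <= n)%N)
    (T1 T2 : R) (T1_gt0 : 0 < T1) (T1_lt_T2 : T1 < T2)
    (xi : {RV P >-> R})
    (xi_UHCS : {ae P, forall w, typeII_UHCS_stops_at r l T1 T2 (X ^~ w) (xi w)}) :
  ('E_P[fun w => (num_failures (X ^~ w) (xi w))%:R] =
   l%:R%:E + n%:R%:E * (F T1 theta)%:E + typeI_hybrid_failures X r T2
   - typeI_hybrid_failures X l T2 - typeI_hybrid_failures X r T1)%E.
Proof.
have lP : (1 <= l <= n)%N by rewrite l_ge1 (leq_trans _ r_le_n)// ltnW.
have rP : (1 <= r <= n)%N by rewrite r_le_n andbT (leq_trans l_ge1)// ltnW.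
pose N (t : Omega -> R) w : R := (num_failures (X ^~ w) (t w))%:R.
pose H k T w := typeI_hybrid_time k T (X ^~ w).
have mX i : measurable_fun setT (X i) by [].
have L t : measurable_fun setT t -> N t \in Lfun P 1.
  by move=> mt; exact: (Lfun1_num_failures P mX mt).
have mN t : measurable_fun setT t -> measurable_fun setT (N t).
  by move=> mt; exact: (measurable_num_failures mX mt).
have mH k T : (1 <= k <= n)%N -> measurable_fun setT (H k T).
  by move=> kn; exact: (measurable_typeI_hybrid_time T mX kn).
have mxi : measurable_fun setT xi by [].
have mT1 : measurable_fun setT (cst T1 : Omega -> R) by [].
have LS : cst l%:R \+ N (cst T1) \in Lfun P 1.
  by apply: rpredD; [exact: Lfun_cst|exact: L].
have ET1 : 'E_P[N (cst T1)]%E = (n%:R%:E * (F T1 theta)%:E)%E.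
  rewrite expectation_num_failures_cst; under eq_bigr do rewrite X_cdf.
  by rewrite sumEFin sumr_const card_ord -EFinM mulr_natl.
have LA : N xi \+ N (H l T2) \in Lfun P 1 by apply: rpredD; apply: L => //; exact: mH.
(* The additive form lets linearity apply to integrable sums before any subtraction in the extended
   reals. *)
have main : ('E_P[N xi] + 'E_P[N (H l T2)] + 'E_P[N (H r T1)] =
    l%:R%:E + n%:R%:E * (F T1 theta)%:E + 'E_P[N (H r T2)])%E.
  rewrite -ET1 -(expectation_cst P) -!expectationD //;
    do ?by [exact: Lfun_cst|apply: L => //; exact: mH].
  apply: expectation_ae_eq.
  - by apply: measurable_funD; [apply: measurable_funD; apply: mN => //|apply: mN];
      exact: mH.
  - by apply: measurable_funD; [apply: measurable_funD => //; exact: mN|apply: mN; exact: mH].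
  have neqT T : {ae P, forall w, forall i, X i w != T}.
    by apply: filter_forall => i; exact: ae_neq_cst (X_cdf i) F_ac.
  have inj := ae_injective X_indep X_ge0 X_cdf F_ac.
  apply: filterS2 (filterI inj xi_UHCS) (filterI (neqT T1) (neqT T2)).
  move=> w [Xinj Xxi] [XT1 XT2]; rewrite /N /= -!natrD; congr _%:R.
  exact: num_failures_UHCS.
(* Cancelling a term in [\bar R] requires it to be finite. *)
have fin k T : (1 <= k <= n)%N -> 'E_P[N (H k T)]%E \is a fin_num.
  by move=> kn; apply: expectation_fin_num; apply: L; exact: mH.
rewrite -[typeI_hybrid_failures X r T2]/('E_P[N (H r T2)])%E -main.
by rewrite addeAC addeK ?fin// addeK ?fin.
Qed.
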